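(* Let $V$ be a finite ground set, $f:2^V\to\mathbb{R}_{\ge0}$ a normalized monotone submodular function with submodular curvature $c\in[0,1)$, $g:2^V\to\mathbb{R}_{\ge0}$ a normalized monotone supermodular function with supermodular curvature $\gamma\in(0,1)$, $\theta>0$, and $S^*$ an optimal solution of $\max\{f(S): g(S)\le\theta\}$. Suppose the Greedy-Ratio-Marginal algorithm is run (continuing past the budget) for $K$ steps and $g(S_K)=\beta^+\theta$ with $\beta^+>1$. Then $$f(S_K)\ge\left[1-\left(\frac{\beta^++\frac{1-\gamma}{\gamma}}{1+\frac{1-\gamma}{\gamma}}\right)^{-\frac{1-\gamma}{\gamma}}\bigl(1-(1-c)(1-\gamma)\bigr)^{\frac{1}{1-c}}\right]f(S^* ).$$
   Context: A function $f$ is normalized if $f(\emptyset)=0$; monotone if $f(A)\le f(B)$ for $A\subseteq B$; submodular if $f(A\cup\{e\})-f(A)\ge f(B\cup\{e\})-f(B)$ for all $A\subseteq B\subseteq V$, $e\in V\setminus B$; supermodular if the reverse inequality holds. Marginals: $g(T\mid S)=g(T\cup S)-g(S)$, $f(v\mid S)=f(S\cup\{v\})-f(S)$, $f(v)=f(\{v\})$. The submodular curvature of $f$ is $c=1-\min_{v,S}\frac{f(v\mid S)}{f(v)}$. The supermodular curvature of $g$ is $\gamma = 1-\min_{S,T\subseteq V:\ g(T)\ge g(S)} \frac{g(T)}{g(T\mid S)}$. The Greedy-Ratio-Marginal algorithm starts from $S_0=\emptyset$ and for $i=0,1,2,\dots$ chooses $v_{i+1}\in\arg\max_{v\notin S_i}\frac{f(v\mid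 S_i)}{g(v\mid S_i)}$ and sets $S_{i+1}=S_i\cup\{v_{i+1}\}$. *)

(* Defs.v *)
From mathcomp Require Import all_boot all_order all_algebra.
From mathcomp Require Import reals constructive_ereal exp.

Set Implicit Arguments.
Unset Strict Implicit.
Unset Printing Implicit Defensive.

Import Order.TTheory GRing.Theory Num.Theory.

Local Open Scope ring_scope.

Definition normalized (R : realType) (V : finType) (h : {set V} -> R) : Prop :=
  h set0 = 0.

Definition monotone (R : realType) (V : finType) (h : {set V} -> R) : Prop :=
  forall A B : {set V}, A \subset B -> h A <= h B.

Definition submodular (R : realType) (V : finType) (h : {set V} -> R) : Prop :=
  forall (A B : {set V}) (e : V), A \subset B -> e \notin B ->
    h (e |: B) - h B <= h (e |: A) - h A.

Definition supermodular (R : realType) (V : finType) (h : {set V} -> R) : Prop :=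
  forall (A B : {set V}) (e : V), A \subset B -> e \notin B ->
    h (e |: A) - h A <= h (e |: B) - h B.

(* h(T | S); the marginal h(v | S) of an element v is that of T = [set v]. *)
Definition marginal (R : realType) (V : finType) (h : {set V} -> R)
    (T S : {set V}) : R :=
  h (T :|: S) - h S.

(* The minimum defining the curvature only ranges over v \notin S with
   f(v) != 0, where the ratio is meaningful and not trivially zero.  For f
   normalized and monotone, the default value 1 of the iterated minimum is the
   ratio at S = set0, so it only matters when f = 0 on all singletons. *)
Definition submodular_curvature (R : realType) (V : finType)
    (f : {set V} -> R) : R :=
  1 - \big[Num.min/1]_(p : V * {set V} | (p.1 \notin p.2) && (f [set p.1] != 0))
        (marginal f [set p.1] p.2 / f [set p.1]).

(* Pairs with g(T | S) = 0 are left out of the minimum: the ratio is then +oo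
   or 0/0 (the latter already at S = T = set0).  For g normalized and monotone,
   the default value 1 is the ratio at S = set0 and any T with g(T) != 0. *)
Definition supermodular_curvature (R : realType) (V : finType)
    (g : {set V} -> R) : R :=
  1 - \big[Num.min/1]_(p : {set V} * {set V} |
          (g p.1 <= g p.2) && (marginal g p.2 p.1 != 0))
        (g p.2 / marginal g p.2 p.1).

(* Division in \bar R: a free element (zero marginal cost) with positive gain
   has ratio +oo, and 0 / 0 = 0. *)
Definition gain_ratio (R : realType) (V : finType) (f g : {set V} -> R)
    (S : {set V}) (v : V) : \bar R :=
  ((marginal f [set v] S)%:E / (marginal g [set v] S)%:E)%E.

Definition greedy_choice (R : realType) (V : finType) (f g : {set V} -> R)
    (S : {set V}) (v : V) : Prop :=
  v \notin S /\
  forall u : V, u \notin S -> (gain_ratio f g S u <= gain_ratio f g S v)%E.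

(* S 0, ..., S K are the sets produced by K steps of Greedy-Ratio-Marginal,
   with arbitrary tie-breaking and no stopping rule; S i is unconstrained for
   i > K. *)
Definition greedy_run (R : realType) (V : finType) (f g : {set V} -> R)
    (K : nat) (S : nat -> {set V}) : Prop :=
  S 0%N = set0 /\
  forall i : nat, (i < K)%N ->
    exists2 v : V, greedy_choice f g (S i) v & S i.+1 = v |: S i.

(* X is an optimal solution of max {f(S) : g(S) <= theta}. *)
Definition optimal_solution (R : realType) (V : finType) (f g : {set V} -> R)
    (theta : R) (X : {set V}) : Prop :=
  g X <= theta /\ forall Y : {set V}, g Y <= theta -> f Y <= f X.

(* Main.v *)
Require Import Defs.
From mathcomp Require Import all_boot all_order all_algebra.
From mathcomp Require Import reals constructive_ereal exp.
From mathcomp Require Import ring lra.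

(** Let [r] be the gain ratio of the current greedy choice and [X] an optimal
    solution.  The ratios are nonincreasing, so every earlier step gained at
    least [r] per unit of cost.  Together with the curvature of [f], this gives
    [f (X :|: S i) >= f X + (1 - c) * r * g (S i :\: X)], while greediness gives
    [f (X :|: S i) - f (S i) <= r * (g (X :|: S i) - g (S i))].  Hence the gap
    [y = f X - f (S i)] satisfies [y <= r * D x], where [x = g (S i) / theta] and
    [D x / theta] is [1 / (1 - gamma) - (1 - c) * x] for [x <= 1] and
    [1 + x * gamma / (1 - gamma)] for [x >= 1], by the curvature of [g].  The
    bound to be proved solves the differential equation
    [y' = - theta * y / D x]; Bernoulli's inequality shows that the discrete
    steps, including the one that crosses the budget, stay below it. *)

Set Implicit Arguments.
Unset Strict Implicit.
Unset Printing Implicit Defensive.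

Import Order.TTheory GRing.Theory Num.Theory.

Local Open Scope ring_scope.

(** * Bernoulli inequalities and one contraction step *)

(** Split off one factor: the power is [(1 + t) * expR ((p - 1) * ln (1 + t))]; then use
    [expR u >= 1 + u] and [(1 + t) * ln (1 + t) >= t]. *)
Lemma bernoulli_powR (R : realType) (p t : R) :
  1 <= p -> -1 < t -> 1 + p * t <= (1 + t) `^ p.
Proof.
move=> p1 t1.
have t0 : 0 < 1 + t by lra.
have lnlb : t <= (1 + t) * ln (1 + t).
  have := expR_ge1Dx (- ln (1 + t)).
  rewrite expRN lnK ?posrE// -(ler_pM2l t0) divff ?gt_eqF// => h; lra.
rewrite /powR gt_eqF//.
have -> : p * ln (1 + t) = ln (1 + t) + (p - 1) * ln (1 + t) by ring.
rewrite expRD lnK ?posrE//.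
apply: le_trans (ler_wpM2l (ltW t0) (expR_ge1Dx _)).
have : (p - 1) * t <= (p - 1) * ((1 + t) * ln (1 + t)).
  by apply: ler_wpM2l => //; lra.
move=> h; lra.
Qed.

Lemma bernoulli_powRN (R : realType) (p t : R) :
  0 <= p -> 0 <= t -> 1 - p * t <= (1 + t) `^ (- p).
Proof.
move=> p0 t0; rewrite /powR gt_eqF; last lra.
apply: le_trans (expR_ge1Dx _); rewrite mulNr.
by rewrite lerD2l lerN2 ler_wpM2l// le_ln1Dx//; lra.
Qed.

(** For [y > 0], [y * k <= r * E] bounds [r] from below, so subtracting [r * D] leaves at most the
    fraction [1 - k * D / E] of [y]. *)
Lemma contraction (R : realType) (y P k r E D q : R) :
  0 <= r -> 0 <= D -> 0 < E -> 0 <= P -> 0 <= q ->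
  y <= P -> y * k <= r * E -> 1 - k * (D / E) <= q -> y - r * D <= P * q.
Proof.
move=> r0 D0 E0 P0 q0 yP yr hq.
have [y0|y0] := leP y 0.
  by apply: (@le_trans _ _ 0); [have := mulr_ge0 r0 D0; lra|exact: mulr_ge0].
apply: (@le_trans _ _ (y * q)); last exact: ler_wpM2r.
apply: (@le_trans _ _ (y * (1 - k * (D / E)))); last by rewrite ler_wpM2l// ltW.
rewrite mulrBr mulr1 lerD2l lerN2.
have -> : y * (k * (D / E)) = y * k * (D / E) by ring.
have -> : r * D = r * E * (D / E) by field; rewrite gt_eqF.
by rewrite ler_wpM2r// divr_ge0// ltW.
Qed.

(** * The envelope and its stability under discrete steps *)

Section Envelope.
Variables (R : realType) (a d al : R).
Hypotheses (a_gt0 : 0 < a) (a_le1 : a <= 1) (al_gt0 : 0 < al).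
Hypothesis d_al : d * (1 + al) = al.

(* [x] is the cost in units of the budget, [a] is [1 - c], [d] is [1 - gamma] and
   [al] is [(1 - gamma) / gamma]. *)
Definition envelope1 (x : R) := (1 - a * d * x) `^ (1 / a).
Definition envelope2 (x : R) := ((x + al) / (1 + al)) `^ (- al).
(** The factor [envelope1 1] glues the two solutions continuously at the budget, since
    [envelope2 1 = 1]. *)
Definition envelope (x : R) :=
  if x <= 1 then envelope1 x else envelope2 x * envelope1 1.

Let d_gt0 : 0 < d.
Proof. by rewrite -(pmulr_lgt0 _ (addr_gt0 ltr01 al_gt0)) d_al. Qed.
Let d_lt1 : d < 1.
Proof.
rewrite -(ltr_pM2r (addr_gt0 ltr01 al_gt0)) d_al mul1r.
by rewrite ltrDr.
Qed.
Let ad_gt0 : 0 < a * d. Proof. exact: mulr_gt0. Qed.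
Let ad_lt1 : a * d < 1.
Proof. by apply: le_lt_trans d_lt1; rewrite ler_piMl// ltW. Qed.

Lemma envelope1_base_gt0 x : x <= 1 -> 0 < 1 - a * d * x.
Proof.
move=> x1; rewrite subr_gt0; apply: le_lt_trans ad_lt1.
by rewrite ler_piMr// ltW.
Qed.

Lemma envelope1_step (F x x' y r : R) :
  0 <= F -> 0 <= r -> 0 <= x -> x <= x' -> x' <= 1 ->
  y <= F * envelope1 x -> y * d <= r * (1 - a * d * x) ->
  y - r * (x' - x) <= F * envelope1 x'.
Proof.
move=> F0 r0 x0 xx' x'1 yF yr.
have E0 := envelope1_base_gt0 (le_trans xx' x'1).
have E'0 := envelope1_base_gt0 x'1.
(* Relative change of the base; Bernoulli with exponent [1 / a >= 1] yields exactly the factor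
   [1 - d * (x' - x) / (1 - a * d * x)]. *)
pose t := - (a * d * (x' - x) / (1 - a * d * x)).
have tE : 1 + t = (1 - a * d * x') / (1 - a * d * x).
  by rewrite /t; field; rewrite gt_eqF.
have t1 : 0 < 1 + t by rewrite tE divr_gt0.
have -> : envelope1 x' = envelope1 x * (1 + t) `^ (1 / a).
  rewrite /envelope1 -powRM; [|exact: ltW..].
  by congr powR; rewrite tE; field; rewrite gt_eqF.
rewrite mulrA; apply: contraction yF yr _ => //.
- by rewrite subr_ge0.
- by rewrite mulr_ge0// powR_ge0.
- exact: powR_ge0.
apply: le_trans (bernoulli_powR _ _); last 2 first.
- by rewrite ler_pdivlMr// mul1r.
- lra.
by rewrite /t le_eqVlt; apply/orP; left; apply/eqP; field; rewrite !gt_eqF.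
Qed.

Lemma envelope2_step (F x x' y r : R) :
  0 <= F -> 0 <= r -> 0 <= x -> x <= x' ->
  y <= F * envelope2 x -> y * al <= r * (al + x) ->
  y - r * (x' - x) <= F * envelope2 x'.
Proof.
move=> F0 r0 x0 xx' yF yr.
have E0 : 0 < al + x by apply: ltr_wpDr.
pose t := (x' - x) / (al + x).
have t0 : 0 <= t by rewrite divr_ge0// ?subr_ge0// ltW.
have -> : envelope2 x' = envelope2 x * (1 + t) `^ (- al).
  rewrite /envelope2 -powRM; last 2 first.
  - by rewrite divr_ge0// addr_ge0// ltW.
  - by rewrite addr_ge0.
  by congr powR; rewrite /t; field; rewrite !gt_eqF// ?addr_gt0// addrC.
rewrite mulrA; apply: contraction yF yr _ => //.
- by rewrite subr_ge0.
- by rewrite mulr_ge0// powR_ge0.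
- exact: powR_ge0.
by apply: bernoulli_powRN => //; exact: ltW.
Qed.

Lemma envelope_step (F x x' y r : R) :
  0 <= F -> 0 <= r -> 0 <= x -> x <= x' -> y <= F * envelope x ->
  (x <= 1 -> y * d <= r * (1 - a * d * x)) ->
  (1 <= x -> y * al <= r * (al + x)) ->
  y - r * (x' - x) <= F * envelope x'.
Proof.
move=> F0 r0 x0 xx' yF yr1 yr2.
have al1 : 0 < 1 + al by rewrite addr_gt0.
have e2_1 : envelope2 1 = 1 by rewrite /envelope2 divff ?powR1 ?gt_eqF.
have e1_ge0 z : 0 <= envelope1 z by exact: powR_ge0.
have [x1|x1] := leP x 1; last first.
  have x'1 : 1 < x' by exact: lt_le_trans xx'.
  move: yF; rewrite /envelope (leNgt x) (leNgt x') x1 x'1/=.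
  rewrite ![envelope2 _ * _]mulrC !mulrA => yF.
  by apply: envelope2_step yF (yr2 (ltW x1)) => //; exact: mulr_ge0.
move: yF; rewrite /envelope x1 => yF.
have [x'1|x'1] := leP x' 1; first by apply: envelope1_step => //; exact: yr1.
(* A step crossing the budget is split at [x = 1]; both pieces have slope [r]. *)
have y1F : y - r * (1 - x) <= F * envelope1 1.
  by apply: envelope1_step => //; exact: yr1.
have -> : y - r * (x' - x) = (y - r * (1 - x)) - r * (x' - 1) by ring.
rewrite [envelope2 _ * _]mulrC mulrA.
apply: envelope2_step => //; [exact: mulr_ge0|exact: ltW|by rewrite e2_1 mulr1|].
(* The first-phase slope bound, carried to [x = 1], implies the second-phase one. *)
have h : y * al <= r * (1 + al - a * x * al).
  have := ler_wpM2r (ltW al1) (yr1 x1).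
  have -> : y * d * (1 + al) = y * (d * (1 + al)) by ring.
  have -> : r * (1 - a * d * x) * (1 + al) =
      r * (1 + al - a * x * (d * (1 + al))) by ring.
  by rewrite d_al.
have hax : 0 <= r * (a * x * al) by rewrite !mulr_ge0// ltW.
have hx : 0 <= r * (al * (1 - x)) by rewrite !mulr_ge0// ?subr_ge0// ltW.
lra.
Qed.

End Envelope.

(** * Marginals, curvatures and the greedy choice *)

Section SetFunctions.
Variables (R : realType) (V : finType).
Implicit Types (f g : {set V} -> R) (A B T : {set V}).

Lemma setU1_absorb e A : e \in A -> e |: A = A.
Proof. by move=> eA; apply/setUidPr; rewrite sub1set. Qed.

Lemma submodular_le f A B e : monotone f -> submodular f -> A \subset B ->
  f (e |: B) - f B <= f (e |: A) - f A.
Proof.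
move=> fm fs AB; have [eB|eB] := boolP (e \in B); last exact: fs.
by rewrite setU1_absorb// subrr subr_ge0; apply: fm; exact: subsetUr.
Qed.

(** As the elements of [T] are added one by one, gains in [f] only shrink and costs in [g] only
    grow, so the bound for single elements persists and telescopes. *)
Lemma gain_bound_setU f g r A : monotone f -> submodular f -> supermodular g ->
  0 <= r ->
  (forall u, u \notin A -> f (u |: A) - f A <= r * (g (u |: A) - g A)) ->
  forall T, f (A :|: T) - f A <= r * (g (A :|: T) - g A).
Proof.
move=> fm fs gs r0 h T; rewrite -(set_enum T).
elim: (enum T) => [|u s IH].
  by rewrite set_nil setU0 !subrr mulr0.
rewrite set_cons setUCA; set B := A :|: _ in IH *.
have [uB|uB] := boolP (u \in B); first by rewrite setU1_absorb.
have AB : A \subset B by exact: subsetUl.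
have uA : u \notin A by apply: contra uB; exact: (subsetP AB).
have := submodular_le u fm fs AB.
have := ler_wpM2l r0 (gs _ _ _ AB uB).
have := h _ uA.
move=> *; lra.
Qed.

Lemma submodular_curvature_le f A v : normalized f -> monotone f ->
  v \notin A ->
  (1 - submodular_curvature f) * f [set v] <= f (v |: A) - f A.
Proof.
move=> f0 fm vA; rewrite /submodular_curvature opprB addrCA subrr addr0.
(* The minimum omits this case; monotonicity settles it. *)
have [fv|fv] := eqVneq (f [set v]) 0.
  by rewrite fv mulr0 subr_ge0; apply: fm; exact: subsetUr.
have fvp : 0 < f [set v] by rewrite lt_neqAle eq_sym fv -[leLHS]f0 fm// sub0set.
rewrite -ler_pdivlMr//.
by apply: (@bigmin_le_cond _ _ _ _ (v, A)); rewrite /= vA fv.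
Qed.

Lemma supermodular_curvature_le g A T : (forall B, 0 <= g B) -> monotone g ->
  g A <= g T ->
  (1 - supermodular_curvature g) * (g (T :|: A) - g A) <= g T.
Proof.
move=> g0 gm gAT; rewrite /supermodular_curvature opprB addrCA subrr addr0.
have [m0|m0] := eqVneq (g (T :|: A) - g A) 0; first by rewrite m0 mulr0.
have mp : 0 < g (T :|: A) - g A.
  by rewrite lt_neqAle eq_sym m0 subr_ge0; apply: gm; exact: subsetUr.
rewrite -ler_pdivlMr//.
by apply: (@bigmin_le_cond _ _ _ _ (A, T)); rewrite /= gAT /marginal.
Qed.

Lemma greedy_choice_gain f g A v : monotone f -> monotone g ->
  greedy_choice f g A v -> 0 < g (v |: A) - g A ->
  forall u, u \notin A -> f (u |: A) - f A <=
    (f (v |: A) - f A) / (g (v |: A) - g A) * (g (u |: A) - g A).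
Proof.
move=> fm gm [vA vmax] gv u uA; move: (vmax _ uA).
rewrite /gain_ratio /marginal !inver [in X in (_ <= X)%E]gt_eqF// -EFinM.
have fu : 0 <= f (u |: A) - f A by rewrite subr_ge0; apply: fm; exact: subsetUr.
have gu : 0 <= g (u |: A) - g A by rewrite subr_ge0; apply: gm; exact: subsetUr.
have [gu0|gu0] := eqVneq (g (u |: A) - g A) 0.
  (* A free element with positive gain would have ratio [+oo], above the finite ratio of [v]. *)
  move: fu; rewrite le_eqVlt => /predU1P[<-|fu]; first by rewrite gu0 mulr0.
  by rewrite gt0_muley ?lte_fin// leye_eq.
by rewrite -EFinM lee_fin ler_pdivrMr// lt_neqAle eq_sym gu0.
Qed.

End SetFunctions.

(** * The optimality gap along a greedy run *)

Section GreedyRun.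
Variables (R : realType) (V : finType) (f g : {set V} -> R).
Variables (K : nat) (S : nat -> {set V}).
Hypotheses (fm : monotone f) (fs : submodular f).
Hypotheses (gm : monotone g) (gs : supermodular g).
Hypothesis run : greedy_run f g K S.

Lemma greedy_run_subset i j : (i <= j)%N -> (j <= K)%N -> S i \subset S j.
Proof.
elim: j => [|j IH]; first by rewrite leqn0 => /eqP->.
rewrite leq_eqVlt => /predU1P[->//|]; rewrite ltnS => ij jK.
have [v _ ->] := run.2 _ jK.
by apply: subset_trans (IH ij (ltnW jK)) _; exact: subsetUr.
Qed.

(* Fixed elements have nonincreasing gain ratios, hence so do the greedy choices. *)
Lemma greedy_slope_le i j : (j <= i)%N -> (i < K)%N ->
  0 < g (S i.+1) - g (S i) ->
  (f (S i.+1) - f (S i)) / (g (S i.+1) - g (S i)) * (g (S j.+1) - g (S j))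
    <= f (S j.+1) - f (S j).
Proof.
move=> ji iK; have jK := leq_ltn_trans ji iK.
have [v vch ->] := run.2 _ iK; have [w wch ->] := run.2 _ jK => gv.
have Sji : S j \subset S i by apply: greedy_run_subset => //; exact: ltnW.
have vSi : v \notin S i by case: vch.
have vSj : v \notin S j by apply: contra vSi; exact: (subsetP Sji).
have fw : 0 <= f (w |: S j) - f (S j).
  by rewrite subr_ge0; apply: fm; exact: subsetUr.
have : 0 <= g (w |: S j) - g (S j).
  by rewrite subr_ge0; apply: gm; exact: subsetUr.
rewrite le_eqVlt => /predU1P[<-|gw]; first by rewrite mulr0.
(* [v] was available at step [j], with no smaller gain and no larger cost than at step [i], and [w]
   had at least its ratio. *)
have h1 := greedy_choice_gain fm gm wch gw vSj.
have h2 := submodular_le v fm fs Sji.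
have h3 := gs Sji vSi.
rewrite -ler_pdivlMr// ler_pdivrMr//.
apply: le_trans h2 _; apply: le_trans h1 _.
by apply: ler_wpM2l => //; rewrite divr_ge0// ltW.
Qed.

(** Each new [v] outside [X] adds at least [(1 - c) * f [set v]] by curvature. Moreover [f [set v]]
    dominates the greedy gain of [v], hence [r] times its cost over [S i], which is at least its
    cost over [S i :\: X]. *)
Lemma greedy_gain_outside (X : {set V}) r i : normalized f -> normalized g ->
  submodular_curvature f <= 1 -> 0 <= r -> (i <= K)%N ->
  (forall j, (j < i)%N -> r * (g (S j.+1) - g (S j)) <= f (S j.+1) - f (S j)) ->
  (1 - submodular_curvature f) * (r * g (S i :\: X)) <= f (X :|: S i) - f X.
Proof.
move=> f0 g0 c1 r0; elim: i => [|i IH] iK h.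
  by rewrite run.1 set0D g0 !mulr0 setU0 subrr.
have {IH} IH := IH (ltnW iK) (fun j ji => h j (ltnW ji)).
have hi := h i (ltnSn i).
have [v [vSi _] Sv] := run.2 _ iK; rewrite Sv in hi *.
rewrite setUCA setDUl.
have [vX|vX] := boolP (v \in X).
  have -> : [set v] :\: X = set0 by apply/eqP; rewrite setD_eq0 sub1set.
  by rewrite set0U setU1_absorb// inE vX.
have -> : [set v] :\: X = [set v].
  by apply/setDidPl; rewrite disjoints1.
have vU : v \notin X :|: S i by rewrite inE negb_or vX.
have h1 := submodular_curvature_le f0 fm vU.
have h2 : f (v |: S i) - f (S i) <= f [set v].
  have := submodular_le v fm fs (sub0set (S i)).
  by rewrite setU0 f0 subr0.
have h3 := gs (subsetDl (S i) X) vSi.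
have h4 : r * (g (v |: S i :\: X) - g (S i :\: X)) <= f [set v].
  by apply: le_trans h2; apply: le_trans hi; exact: ler_wpM2l.
have : (1 - submodular_curvature f) *
    (r * (g (v |: S i :\: X) - g (S i :\: X))) <=
    (1 - submodular_curvature f) * f [set v].
  by apply: ler_wpM2l => //; rewrite subr_ge0.
move=> *; lra.
Qed.

Lemma greedy_gap_le (X : {set V}) i : normalized f -> normalized g ->
  submodular_curvature f <= 1 -> (i < K)%N -> 0 < g (S i.+1) - g (S i) ->
  f X - f (S i) <= (f (S i.+1) - f (S i)) / (g (S i.+1) - g (S i)) *
    (g (X :|: S i) - g (S i) - (1 - submodular_curvature f) * g (S i :\: X)).
Proof.
move=> f0 g0 c1 iK gv; set r := _ / _.
have r0 : 0 <= r.
  by rewrite divr_ge0 ?(ltW gv)// subr_ge0; apply: fm; exact: greedy_run_subset.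
have h1 : (1 - submodular_curvature f) * (r * g (S i :\: X)) <=
    f (X :|: S i) - f X.
  apply: greedy_gain_outside => //; first exact: ltnW.
  by move=> j ji; apply: greedy_slope_le => //; exact: ltnW.
have : f (S i :|: X) - f (S i) <= r * (g (S i :|: X) - g (S i)).
  apply: gain_bound_setU => // u.
  move: gv; rewrite /r; have [v vch ->] := run.2 _ iK => gv.
  exact: greedy_choice_gain.
rewrite ![S i :|: X]setUC => h2; lra.
Qed.

End GreedyRun.

(** * Cost of adding an optimal solution *)

Section Cost.
Variables (R : realType) (V : finType) (g : {set V} -> R) (theta : R).
Variables (X A : {set V}).
Hypotheses (g_ge0 : forall B, 0 <= g B) (gm : monotone g).
Hypothesis gX : g X <= theta.
Let d := 1 - supermodular_curvature g.
Hypotheses (d_gt0 : 0 < d) (d_lt1 : d < 1).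

(** The curvature bound needs the added set to be the costlier one, so it is applied to [A] over
    [X]; exchanging the subtracted terms gives the marginal of [X] over [A]. *)
Lemma supermodular_cost_over : g X <= g A ->
  d * (g (X :|: A) - g A) <= d * g X + (1 - d) * g A.
Proof.
move=> XA; have := supermodular_curvature_le g_ge0 gm XA.
rewrite -/d setUC => h; lra.
Qed.

Lemma supermodular_cost_under : g A <= theta ->
  d * (g (X :|: A) - g A) <= theta.
Proof.
move=> At; have [XA|/ltW AX] := leP (g X) (g A).
  (* This bound is a convex combination of [g X] and [g A], both at most [theta]. *)
  apply: le_trans (supermodular_cost_over XA) _.
    have h1 := ler_wpM2l (ltW d_gt0) gX.
    have h2 : (1 - d) * g A <= (1 - d) * theta.
      by apply: ler_wpM2l => //; rewrite subr_ge0; exact: ltW.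
    lra.
by apply: le_trans gX; exact: supermodular_curvature_le.
Qed.

End Cost.

(** * Induction along the run and conclusion *)

Lemma greedy_envelope (R : realType) (V : finType) (f g : {set V} -> R)
    (theta al : R) (X : {set V}) (K : nat) (S : nat -> {set V}) :
  (forall A, 0 <= f A) -> normalized f -> monotone f -> submodular f ->
  0 <= submodular_curvature f < 1 ->
  (forall A, 0 <= g A) -> normalized g -> monotone g -> supermodular g ->
  0 < supermodular_curvature g < 1 ->
  0 < theta -> g X <= theta -> greedy_run f g K S ->
  (1 - supermodular_curvature g) * (1 + al) = al ->
  forall i, (i <= K)%N -> f X - f (S i) <= f X *
    envelope (1 - submodular_curvature f) (1 - supermodular_curvature g) al
      (g (S i) / theta).
Proof.
move=> f_ge0 f0 fm fs /andP[c0 c1] g_ge0 g0 gm gs /andP[ga0 ga1] t0 gX run hal.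
set a := 1 - _; set d := 1 - _.
have a0 : 0 < a by rewrite subr_gt0.
have a1 : a <= 1 by rewrite lerBlDr lerDl.
have d0 : 0 < d by rewrite subr_gt0.
have d1 : d < 1 by rewrite ltrBlDr ltrDl.
have hd : (1 - d) * al = d by rewrite mulrBl mul1r -{1}hal mulrDr mulr1 addrK.
have al0 : 0 < al.
  by move: d0; rewrite -hd pmulr_rgt0// subr_gt0.
elim=> [_|i IH iK].
  rewrite run.1 f0 g0 mul0r /envelope ler01 /envelope1 mulr0 !subr0 powR1.
  by rewrite mulr1.
have {}IH := IH (ltnW iK).
have Sii : S i \subset S i.+1 by exact: (greedy_run_subset run).
have : 0 <= g (S i.+1) - g (S i) by rewrite subr_ge0; exact: gm.
(* A step of zero cost leaves the envelope in place and cannot widen the gap. *)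
rewrite le_eqVlt => /predU1P[/esym/eqP|gv].
  rewrite subr_eq0 => /eqP->; apply: le_trans IH.
  by rewrite lerD2l lerN2; exact: fm.
have gap := greedy_gap_le fm fs gm gs run X f0 g0 (ltW c1) iK gv.
set r := _ / _ in gap.
have r0 : 0 <= r by rewrite divr_ge0 ?(ltW gv)// subr_ge0; exact: fm.
have xE : (f (S i.+1) - f (S i)) =
    (r * theta) * (g (S i.+1) / theta - g (S i) / theta).
  by rewrite /r; field; rewrite !gt_eqF.
have -> : f X - f (S i.+1) = f X - f (S i) -
    (r * theta) * (g (S i.+1) / theta - g (S i) / theta).
  by rewrite -xE; ring.
have DX : g (S i :\: X) <= g (S i) by apply: gm; exact: subsetDl.
have DX0 := g_ge0 (S i :\: X).
apply: envelope_step => //.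
- by rewrite mulr_ge0// ltW.
- by rewrite divr_ge0// ltW.
- by rewrite ler_pM2r ?invr_gt0//; exact: gm.
- rewrite ler_pdivrMr// mul1r => xt.
  have -> : r * theta * (1 - a * d * (g (S i) / theta)) =
      r * (theta - a * d * g (S i)) by field; rewrite gt_eqF.
  rewrite mulrC; apply: (le_trans (ler_wpM2l (ltW d0) gap)).
  rewrite -/a mulrCA ler_wpM2l//.
  (* The curvature bound is taken over [S i :\: X]; passing from [g (S i :\: X)] to [g (S i)] then
     only involves the weight [1 - a >= 0]. *)
  have Dt : g (S i :\: X) <= theta by exact: le_trans xt.
  have := supermodular_cost_under g_ge0 gm gX d0 d1 Dt; rewrite -/d.
  have -> : X :|: S i :\: X = X :|: S i.
    by apply/setP => z; rewrite !inE; case: (z \in X).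
  move=> h; have h2 : 0 <= d * ((1 - a) * (g (S i) - g (S i :\: X))).
    by rewrite !mulr_ge0 ?subr_ge0// ltW.
  lra.
- rewrite ler_pdivlMr// mul1r => xt.
  have -> : r * theta * (al + g (S i) / theta) =
      r * (al * theta + g (S i)) by field; rewrite gt_eqF.
  rewrite mulrC; apply: (le_trans (ler_wpM2l (ltW al0) gap)).
  rewrite -/a mulrCA ler_wpM2l//.
  have := supermodular_cost_over g_ge0 gm (le_trans gX xt); rewrite -/d.
  (* This turns the cost bound into [g X + g (S i) / al]; the term in [a] is then discarded. *)
  have hd1 : 1 - d = d / al.
    by rewrite -[in RHS]hd mulfK// gt_eqF.
  rewrite hd1 => h.
  have {}h : d * (al * (g (X :|: S i) - g (S i))) <=
      d * (al * g X + g (S i)).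
    rewrite mulrCA; apply: le_trans (ler_wpM2l (ltW al0) h) _.
    by rewrite le_eqVlt; apply/orP; left; apply/eqP; field; rewrite gt_eqF.
  rewrite ler_pM2l// in h.
  have h2 : 0 <= al * (a * g (S i :\: X)) by rewrite !mulr_ge0// ltW.
  have h3 := ler_wpM2l (ltW al0) gX.
  lra.
Qed.

Theorem mainTheorem8 (R : realType) (V : finType) (f g : {set V} -> R)
    (c gamma theta beta : R) (Sopt : {set V}) (K : nat) (S : nat -> {set V})
    (f_ge0 : forall A : {set V}, 0 <= f A)
    (f_normalized : normalized f) (f_monotone : monotone f)
    (f_submodular : submodular f)
    (c_def : c = submodular_curvature f) (c_range : 0 <= c < 1)
    (g_ge0 : forall A : {set V}, 0 <= g A)
    (g_normalized : normalized g) (g_monotone : monotone g)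
    (g_supermodular : supermodular g)
    (gamma_def : gamma = supermodular_curvature g) (gamma_range : 0 < gamma < 1)
    (theta_gt0 : 0 < theta)
    (Sopt_optimal : optimal_solution f g theta Sopt)
    (S_greedy : greedy_run f g K S)
    (gSK : g (S K) = beta * theta) (beta_gt1 : 1 < beta) :
  f (S K) >=
    (1 - ((beta + (1 - gamma) / gamma) / (1 + (1 - gamma) / gamma))
           `^ (- ((1 - gamma) / gamma))
         * (1 - (1 - c) * (1 - gamma)) `^ (1 / (1 - c)))
    * f Sopt.
Proof.
have gamma_gt0 : 0 < gamma by case/andP: gamma_range.
set al := (1 - gamma) / gamma.
have hal : (1 - gamma) * (1 + al) = al by rewrite /al; field; rewrite gt_eqF.
rewrite c_def in c_range *; rewrite gamma_def in gamma_range hal *.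
have := greedy_envelope f_ge0 f_normalized f_monotone f_submodular c_range g_ge0
  g_normalized g_monotone g_supermodular gamma_range theta_gt0 Sopt_optimal.1
  S_greedy hal (leqnn K).
(* As [beta > 1], the run ends in the second phase, where the envelope at [beta] is the claimed
   factor. *)
rewrite gSK mulfK ?gt_eqF// /envelope (leNgt beta) beta_gt1/= /envelope1 /envelope2.
by rewrite mulr1 => h; lra.
Qed.
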